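(* Let $m\ge0$ and $n\ge\ell\ge1$ be integers, let $\mathbf{x}=(x_1,\dots,x_n)$ and $t_1,\dots,t_n$ be commuting indeterminates, and set $\mathbf{t}=(t_1,\dots,t_{\ell-1})$. Then $$\sum_{\lambda\subseteq m^\ell}\ \prod_{i=1}^{\ell}t_i^{m-\lambda_i}\ g_\lambda(\mathbf{x};\mathbf{t})=\prod_{i=1}^{\ell}t_i^m\ \prod_{1\le i<j\le n}\frac{1}{(x_i-x_j)(t_i^{-1}-t_j^{-1})}\ \det\left[\frac{(x_it_j^{-1})^{m+n}-1}{x_it_j^{-1}-1}\right]_{i,j=1}^{n}\Biggr|_{t_{\ell+1}=\cdots=t_n=\infty}.$$
   Context: $m^\ell$ is the rectangular partition with $\ell$ parts equal to $m$, and the sum is over all partitions $\lambda=(\lambda_1\ge\dots\ge\lambda_\ell\ge0)$ with $\lambda_1\le m$. The evaluation $t_{\ell+1}=\cdots=t_n=\infty$ means: regard the quotient of the determinant by $\prod_{i<j}(x_i-x_j)(t_i^{-1}-t_j^{-1})$ as a polynomial in $x_1,\dots,x_n,t_1^{-1},\dots,t_n^{-1}$ and set $t_j^{-1}=0$ for $\ell<j\le n$. A reverse plane partition of shape $\lambda$ (English convention, row 1 at the top) is a filling of the boxes of $\lambda$ with positive integers that weakly increases along rows and down columns. Let $\mathrm{RPP}^n(\lambda)$ be the set of those with all entries at most $n$. For $T\in\mathrm{RPP}^n(\lambda)$, let $a_i$ be the number of columns of $T$ containing $i$, and let $b_r$ be the number of boxes in row $r$ whose entry equals the entry in the box directly below.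 The refined dual Grothendieck polynomial is $g_\lambda(\mathbf{x};\mathbf{t}):=\sum_{T\in\mathrm{RPP}^n(\lambda)}\prod_{r}t_r^{b_r}\prod_{i}x_i^{a_i}$ (only $t_1,\dots,t_{\ell(\lambda)-1}$ occur). *)

(* Defs.v *)
From HB Require Import structures.
From mathcomp Require Import all_boot all_order all_algebra.
From mathcomp.multinomials Require Import mpoly.

Set Implicit Arguments.
Unset Strict Implicit.
Unset Printing Implicit Defensive.

Import GRing.Theory.
Local Open Scope ring_scope.

(* Rows, columns and entries are numbered from 0: box (r, c) below is the box
   in row r+1 and column c+1, and the entry i : 'I_n stands for i+1.
   A partition is given by l weakly decreasing parts, zero parts allowed. *)

Section ReversePlanePartitions.

Variables (l : nat) (la : l.-tuple nat).

Definition is_part : bool := sorted geq la.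

Definition box : Type :=
  {b : 'I_l * 'I_(head 0%N la) | (b.2 < tnth la b.1)%N}.

Definition brow (b : box) : 'I_l := (val b).1.
Definition bcol (b : box) : 'I_(head 0%N la) := (val b).2.

Variable n : nat.

Definition is_rpp (T : {ffun box -> 'I_n}) : bool :=
  [forall b : box, forall b' : box,
     [&& brow b == brow b' & (bcol b <= bcol b')%N] ==> (T b <= T b')%N]
  && [forall b : box, forall b' : box,
     [&& bcol b == bcol b' & (brow b <= brow b')%N] ==> (T b <= T b')%N].

Definition rpp_a (T : {ffun box -> 'I_n}) (i : 'I_n) : nat :=
  #|[set c | [exists b : box, (bcol b == c) && (T b == i)]]|.

Definition rpp_b (T : {ffun box -> 'I_n}) (r : nat) : nat :=
  #|[set b : box | (brow b == r :> nat) &&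
      [exists b' : box, [&& bcol b' == bcol b,
                            brow b' == (brow b).+1 :> nat & T b' == T b]]]|.

(* The last of the l rows has no box below it, so l - 1 parameters t suffice. *)
Definition refined_g (R : comNzRingType) (x : 'I_n -> R) (t : 'I_l.-1 -> R) : R :=
  \sum_(T : {ffun box -> 'I_n} | is_rpp T)
    (\prod_(r < l.-1) t r ^+ rpp_b T r) * (\prod_(i < n) x i ^+ rpp_a T i).

End ReversePlanePartitions.

(* The field Q(x_1, ..., x_n, t_1, ..., t_n), as the fraction field of the
   polynomial ring over the integers. *)
Definition ratfun (n : nat) : fieldType := {fraction {mpoly int[n + n]}}.

Definition xvar (n : nat) (i : 'I_n) : ratfun n :=
  @FracField.tofrac {mpoly int[n + n]} 'X_(lshift n i).

Definition tvar (n : nat) (j : 'I_n) : ratfun n :=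
  @FracField.tofrac {mpoly int[n + n]} 'X_(rshift n j).

(* P(x_1, ..., x_n, u_1, ..., u_n): the first n variables of P take the values
   x, the last n the values u. *)
Definition eval_xu (n : nat) (x u : 'I_n -> ratfun n)
    (P : {mpoly int[n + n]}) : ratfun n :=
  mmap (fun z : int => z%:~R)
    (fun k => match split k with inl i => x i | inr j => u j end) P.

(* Main.v *)
(* With u_j = 1 / t_j, the determinant divided by the Vandermonde products is
   det (H_x H_u^T), where H_y is the n x (m + n) matrix of the complete
   homogeneous polynomials h_(k - i)(y); this is the polynomial P.  Setting
   u_j = 0 for j >= l shrinks it to an l x l determinant, which multiplied by
   t^m becomes det [h_(m - i + j)(x, t_1, ..., t_l)].

   On the combinatorial side, peeling off the boxes with the largest entry gives
   a recursion over chains of partitions, from which the Jacobi-Trudi formula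
   g_la(x; t) = det [h_(la_i - i + j)(x, t_1, ..., t_(i-1))] follows by summing
   the parts of the inner partition one after the other, each sum being a row
   operation.  The sum over la is one more such recursion step, for the
   rectangle m^l with new variable t_l, so it yields
   det [h_(m - i + j)(x, t_l, t_1, ..., t_(i-1))], which row operations turn into
   the determinant above. *)
Require Import Defs.
From HB Require Import structures.
From mathcomp Require Import all_boot all_order all_algebra.
From mathcomp Require Import ring zify.
From mathcomp.multinomials Require Import mpoly.

Set Implicit Arguments.
Unset Strict Implicit.
Unset Printing Implicit Defensive.

Import GRing.Theory.
Local Open Scope ring_scope.

(** * Products of geometric series *)

Section Series.
Variable R : comNzRingType.
Implicit Types (f g y z : nat -> R).

(* Multiplication of the power series [\sum_e f e z^e] by [1 / (1 - x z)]. *)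
Fixpoint geo (x : R) f e : R := if e is e'.+1 then f e + x * geo x f e' else f 0%N.

Definition geos (y : nat -> R) k f : nat -> R := iteri k (fun i => geo (y i)) f.

(* [geos y k (delta d) e] is the complete homogeneous polynomial h_(e - d) in
   y_0, ..., y_(k-1); the shift by [d] keeps negative degrees within [nat]. *)
Definition delta (d e : nat) : R := (e == d)%:R.

Lemma eq_geo x f g : f =1 g -> geo x f =1 geo x g.
Proof. by move=> fg; elim=> [|e IH] /=; rewrite fg ?IH. Qed.

Lemma eq_geos y z k f g :
  (forall i, (i < k)%N -> y i = z i) -> f =1 g -> geos y k f =1 geos z k g.
Proof.
elim: k => // k IH yz fg e; rewrite /= yz //; apply: eq_geo => // e'.
by apply: IH => // i ik; apply: yz; apply: ltnW.
Qed.

(** Partial fractions: (x - y) / ((1 - xz)(1 - yz)) = x / (1 - xz) - y / (1 - yz), multiplied by the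
    series of [f]. *)
Lemma geo_geo (x y : R) f e :
  (x - y) * geo x (geo y f) e = x * geo x f e - y * geo y f e.
Proof.
elim: e => [|e IH] /=; first by ring.
rewrite mulrDr [_ * (x * _)]mulrCA IH; ring.
Qed.

(** The two sides of the recursion for [e.+1] differ exactly by the identity [geo_geo] in degree
    [e]. *)
Lemma geoC (x y : R) f : geo x (geo y f) =1 geo y (geo x f).
Proof.
elim=> //= e IH; move: (geo_geo x y f e); rewrite -IH => E.
apply/eqP; rewrite -subr_eq0; apply/eqP.
transitivity ((x - y) * geo x (geo y f) e - (x * geo x f e - y * geo y f e)).
  by ring.
by rewrite E subrr.
Qed.

Lemma geo_geos x y k f : geo x (geos y k f) =1 geos y k (geo x f).
Proof. by elim: k => // k IH e; rewrite /= geoC; apply: eq_geo. Qed.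

Lemma geos_add y a b f : geos y (a + b) f = geos (fun i => y (a + i)%N) b (geos y a f).
Proof. by elim: b => [|b IH]; rewrite ?addn0 // addnS /geos /= -!/(geos _ _ _) IH. Qed.

Lemma geo_sum x f e : geo x f e = \sum_(j < e.+1) x ^+ (e - j) * f j.
Proof.
elim: e => [|e IH]; first by rewrite big_ord1 mul1r.
rewrite big_ord_recr /= subnn mul1r addrC IH mulr_sumr; congr (_ + _).
by apply: eq_bigr => j _; rewrite mulrA -exprS subSn // -ltnS.
Qed.

Lemma geo0 f : geo 0 f =1 f.
Proof. by case=> //= e; rewrite mul0r addr0. Qed.

Lemma geos0 y k f : (forall i, (i < k)%N -> y i = 0) -> geos y k f =1 f.
Proof.
elim: k => // k IH y0 e; rewrite /= y0 // geo0; apply: IH => i ik.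
by apply/y0/ltnW.
Qed.

(** The vanishing in degree [0] is what starts the induction on [e] for the shift. *)
Lemma geos_shift y k d e :
  geos y k (delta d.+1) 0 = 0 /\ geos y k (delta d.+1) e.+1 = geos y k (delta d) e.
Proof.
elim: k e => [|k IH] e; first by rewrite /= /delta eqSS.
have h0 : geos y k.+1 (delta d.+1) 0 = 0 by rewrite /=; case: (IH 0%N).
split=> //; elim: e => [|e IHe].
  have /= := h0; rewrite /geos /= -!/(geos _ _ _) => ->.
  by rewrite mulr0 addr0; case: (IH 0%N).
move: IHe; rewrite /geos /= -!/(geos _ _ _) => ->.
by case: (IH e.+1) => _ ->.
Qed.

Lemma geos_addr y k d c e : geos y k (delta (d + c)) (e + c) = geos y k (delta d) e.
Proof.
elim: c => [|c IH]; rewrite ?addn0 // !addnS -IH.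
by case: (geos_shift y k (d + c) (e + c)).
Qed.

Lemma geo_vanish (x : R) f d :
  (forall e, (e < d)%N -> f e = 0) -> forall e, (e < d)%N -> geo x f e = 0.
Proof.
move=> f0; elim=> [|e IH] el /=; rewrite f0 // IH ?mulr0 ?addr0 //; exact: ltnW.
Qed.

Lemma geos_vanish y k f d :
  (forall e, (e < d)%N -> f e = 0) -> forall e, (e < d)%N -> geos y k f e = 0.
Proof. by move=> f0; elim: k => // k IH e el; apply: geo_vanish el. Qed.

Lemma geos_lt y k d e : (e < d)%N -> geos y k (delta d) e = 0.
Proof. by apply: geos_vanish => {}e; rewrite /delta => /ltn_eqF ->. Qed.

Lemma geos_diag y k d : geos y k (delta d) d = 1.
Proof.
rewrite -[X in delta X]add0n -[X in geos _ _ _ X]add0n geos_addr.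
by elim: k.
Qed.

Lemma geo_delta (y : R) d k : geo y (delta d) (k + d) = y ^+ k.
Proof.
rewrite (@geos_addr (fun _ => y) 1 0 d k : geo y (delta d) (k + d) = geo y (delta 0) k).
by elim: k => //= k ->; rewrite add0r exprS.
Qed.

(* The coefficients of [\prod_(i < s) (1 - y i * 'X)]. *)
Fixpoint ecoef (y : nat -> R) s : nat -> R :=
  if s is s'.+1 then
    fun q => ecoef y s' q - (if q is q'.+1 then y s' * ecoef y s' q' else 0)
  else fun q => (q == 0)%N%:R.

Lemma ecoef0 y s : ecoef y s 0 = 1.
Proof. by elim: s => //= s ->; rewrite subr0. Qed.

Lemma ecoef_gt y s q : (s < q)%N -> ecoef y s q = 0.
Proof.
elim: s q => [|s IH] [|q] //= sq; rewrite IH ?IH ?mulr0 ?subr0 //; exact: ltnW.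
Qed.

(** Multiplying by all the factors [1 - y i * 'X] undoes [geos y s]. The bound [s <= e] keeps every
    [e - q] free of truncation. *)
Lemma ecoef_geos y s f e : (s <= e)%N ->
  f e = \sum_(q < s.+1) ecoef y s q * geos y s f (e - q).
Proof.
elim: s f e => [|s IH] f e se; first by rewrite big_ord1 /= mul1r subn0.
have geoE g e' : (0 < e')%N -> g e' = geo (y s) g e' - y s * geo (y s) g e'.-1.
  by case: e' => //= e' _; rewrite addrK.
rewrite (IH f e (ltnW se)).
transitivity (\sum_(q < s.+1) (ecoef y s q * geos y s.+1 f (e - q)
                - y s * ecoef y s q * geos y s.+1 f (e - q.+1))).
  apply: eq_bigr => q _.
  rewrite (geoE (geos y s f)); last by rewrite subn_gt0 (leq_ltn_trans _ se) // -ltnS.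
  by rewrite -subnS /geos /= -!/(geos _ _ _); ring.
rewrite sumrB.
have -> : \sum_(q < s.+2) ecoef y s.+1 q * geos y s.+1 f (e - q) =
  \sum_(q < s.+2) ecoef y s q * geos y s.+1 f (e - q)
  - \sum_(q < s.+2) (if q : nat is q'.+1 then y s * ecoef y s q' else 0)
                      * geos y s.+1 f (e - q).
  by rewrite -sumrB; apply: eq_bigr => q _; rewrite /= mulrBl.
congr (_ - _).
  by rewrite [RHS]big_ord_recr /= ecoef_gt // mul0r addr0.
by rewrite [RHS]big_ord_recl /= mul0r add0r; apply: eq_bigr => q _.
Qed.

End Series.

(** * Determinants of complete homogeneous polynomials *)

Section Determinants.
Variable R : comNzRingType.
Implicit Types (f g y z : nat -> R).

Lemma det_unitriangular n (A : 'M[R]_n) :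
  (forall i j : 'I_n, (j < i)%N -> A i j = 0) -> (forall i, A i i = 1) -> \det A = 1.
Proof.
move=> A0 A1; rewrite -det_tr det_trig; last first.
  by apply/is_trig_mxP => i j ij; rewrite mxE A0.
by rewrite big1 // => i _; rewrite mxE.
Qed.

(** The factors commute, so that of [y i] can be moved innermost; [bump i] lists the other
    variables. *)
Lemma geos_bump y n i f : (i <= n)%N ->
  geos y n.+1 f =1 geos (y \o bump i) n (geo (y i) f).
Proof.
elim: n => [|n IH]; first by rewrite leqn0 => /eqP ->.
rewrite leq_eqVlt => /orP[/eqP -> | ilt] e.
  transitivity (geos y n.+1 (geo (y n.+1) f) e);
    first exact: (geo_geos (y n.+1) y n.+1 f e).
  by apply: eq_geos => // j jn; rewrite /= /bump leqNgt jn.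
rewrite -[LHS]/(geo (y n.+1) (geos y n.+1 f) e).
rewrite -[RHS]/(geo (y (bump i n)) (geos (y \o bump i) n (geo (y i) f)) e).
by rewrite /bump -ltnS ilt add1n; apply: eq_geo; apply: IH.
Qed.

(* Row [i] inverts all the factors [1 / (1 - y_q z)] with [q != i]. *)
Definition comp_mx y n : 'M[R]_n := \matrix_(i, j) ecoef (y \o bump i) n.-1 j.

Lemma comp_mxP y n f e (i : 'I_n) : (n <= e.+1)%N ->
  geo (y i) f e = \sum_(j < n) comp_mx y n i j * geos y n f (e - j).
Proof.
case: n i => [[]|n] // i ne; rewrite (@ecoef_geos _ (y \o bump i) n) //.
by apply: eq_bigr => j _; rewrite mxE (geos_bump _ _ (leq_ord i)).
Qed.

(** Entry (i, k) is h_(k - i)(y): the shift [n] in [delta] is compensated in the index, where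
    [n - i] is never truncated. *)
Definition h_mx y n N : 'M[R]_(n, N) :=
  \matrix_(i, k) geos y n (delta R n) (k + (n - i)).

Definition pow_mx y n N : 'M[R]_(n, N) := \matrix_(i, k) y i ^+ k.

(** Inverting all factors but one leaves 1 / (1 - y_i z), whose coefficients are the powers of
    [y i]. *)
Lemma comp_mx_h_mx y n N : comp_mx y n *m h_mx y n N = pow_mx y n N.
Proof.
apply/matrixP => i k; rewrite !mxE -(geo_delta _ n) comp_mxP; last by lia.
by apply: eq_bigr => j _; rewrite !mxE addnBA // ltnW.
Qed.

(** For [N = n] the matrix [h_mx] is upper unitriangular. *)
Lemma det_comp_mx y n : \det (comp_mx y n) = \det (pow_mx y n n).
Proof.
rewrite -comp_mx_h_mx det_mulmx [X in _ * X]det_unitriangular ?mulr1 //.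
  move=> i j ji; rewrite mxE geos_lt //; have := ltn_ord i; lia.
by move=> i; rewrite mxE subnKC ?geos_diag // ltnW.
Qed.

Lemma det_pow_mx y n : \det (pow_mx y n n) =
  \prod_(i < n) \prod_(j < n | (i < j)%N) (y j - y i).
Proof.
have -> : pow_mx y n n = (Vandermonde n (\row_i y i))^T.
  by apply/matrixP => i j; rewrite !mxE.
rewrite det_tr det_Vandermonde; apply: eq_bigr => i _; apply: eq_bigr => j _.
by rewrite !mxE.
Qed.

(** Both power matrices factor through [comp_mx], which contributes the Vandermonde determinants;
    their product has truncated geometric series as entries. *)
Lemma det_h_mx_vandermonde y z n N :
  \det (pow_mx y n n) * \det (pow_mx z n n) * \det (h_mx y n N *m (h_mx z n N)^T) =
  \det (\matrix_(i < n, j < n) \sum_(k < N) (y i * z j) ^+ k).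
Proof.
transitivity (\det (pow_mx y n N *m (pow_mx z n N)^T)).
  rewrite -[pow_mx y n N]comp_mx_h_mx -[pow_mx z n N]comp_mx_h_mx trmx_mul
    mulmxA -(mulmxA (comp_mx y n)) !det_mulmx.
  by rewrite det_tr !det_comp_mx; ring.
congr (\det _); apply/matrixP => i j; rewrite !mxE.
by apply: eq_bigr => k _; rewrite !mxE exprMn.
Qed.

(** Only [l] of the [u i] survive, so row operations turn the first [n - l] rows of
    [h_mx u n (m + n)] into unit vectors, and the determinant shrinks to a block of size [l]. *)
Lemma det_h_mx_stable x u n l m :
  (l <= n)%N -> (forall i, (l <= i)%N -> u i = 0) ->
  \det (h_mx x n (m + n) *m (h_mx u n (m + n))^T) =
  \det (\matrix_(r < l, q < l) \sum_(k < m + l)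
     geos x n (delta R l) (k + (l - r)) * geos u l (delta R l) (k + (l - q))).
Proof.
move=> /subnK <- u0; move: (n - l)%N => {n}d; set n := (d + l)%N; set N := (m + n)%N.
have nE : n = (d + l)%N by [].
have NE : N = (m + n)%N by [].
have hu f e : geos u n f e = geos u l f e.
  rewrite /n addnC geos_add geos0 // => i _; exact/u0/leq_addr.
(* Row [i < d] of [S] multiplies by the product of the factors [1 - u q * 'X], leaving the unit
   vector of index [i]; the last [l] rows are kept. *)
pose S : 'M[R]_n := \matrix_(i, j)
  if (i < d)%N then (if (i <= j)%N then ecoef u l (j - i) else 0) else (i == j)%:R.
have detS : \det S = 1.
  apply: det_unitriangular => [i j ji | i]; rewrite mxE.
    rewrite [(i <= j)%N]leqNgt ji /=; case: ifP => // _; case: eqP => // ij.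
    by rewrite ij ltnn in ji.
  by rewrite leqnn subnn ecoef0 eqxx; case: ifP.
pose A := h_mx x n N *m (S *m h_mx u n N)^T.
transitivity (\det A).
  by rewrite /A trmx_mul mulmxA [RHS]det_mulmx det_tr detS mulr1.
have ShuE (i : 'I_n) (k : 'I_N) : (S *m h_mx u n N) i k =
    if (i < d)%N then (k == i :> nat)%:R else h_mx u n N i k.
  rewrite mxE; case: ifP => id; last first.
    rewrite (bigD1 i) //= mxE id eqxx mul1r big1 ?addr0 // => j ji.
    by rewrite mxE id eq_sym (negbTE ji) mul0r.
  have -> : (k == i :> nat) = ((k + (n - i))%N == n).
    by have := ltn_ord i; lia.
  rewrite -/(delta R n (k + (n - i))) (@ecoef_geos _ u l); last first.
    lia.
  rewrite (eq_bigr (fun j : 'I_n => if (i <= j)%N then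
     ecoef u l (j - i) * geos u l (delta R n) (k + (n - j)) else 0)); last first.
    by move=> j _; rewrite !mxE id hu; case: ifP; rewrite ?mul0r.
  rewrite -big_mkcond /= -(big_mkord (fun j => i <= j)%N
     (fun j => ecoef u l (j - i) * geos u l (delta R n) (k + (n - j)))).
  rewrite -(big_mkord predT
    (fun q => ecoef u l q * geos u l (delta R n) (k + (n - i) - q))).
  rewrite (big_cat_nat (n := i)) //=; last exact/ltnW/ltn_ord.
  rewrite big_nat_cond big_pred0 ?add0r; last by move=> j; lia.
  (* Since [i < d], all [l.+1] coefficients fit into the [n] columns; [ecoef] vanishes beyond
     them. *)
  rewrite (big_cat_nat (n := i + l.+1)) //=; last 2 first.
  - lia.
  - by lia.
  rewrite [X in _ + X]big_nat_cond [X in _ + X]big1 ?addr0; last first.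
    by move=> j jP; rewrite ecoef_gt ?mul0r //; lia.
  rewrite -{1}[i : nat]add0n big_addn [(i + _)%N]addnC addnK big_nat_cond [RHS]big_nat.
  apply: eq_big => [q|q qP]; first lia.
  by rewrite addnK; congr (_ * geos _ _ _ _); lia.
have AE (i j : 'I_n) : A i j = \sum_(0 <= k < N) geos x n (delta R n) (k + (n - i)) *
    if (j < d)%N then (k == j)%:R else geos u l (delta R n) (k + (n - j)).
  rewrite /A mxE big_mkord; apply: eq_bigr => k _; rewrite !mxE -hu; congr (_ * _).
  by have := ShuE j k; rewrite !mxE.
have A1 (i j : 'I_n) : (j < d)%N -> A i j = geos x n (delta R n) (j + (n - i)).
  move=> jd; have jN : (j < N)%N by rewrite /N ltn_addl.
  rewrite AE jd big_mkord (bigD1 (Ordinal jN)) //= eqxx mulr1 big1 ?addr0 // => k.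
  by rewrite -val_eqE /= => /negbTE ->; rewrite mulr0.
(* The first [d] columns of [A] are h_(j - i)(x), unitriangular on top and zero below, so only the
   lower right block counts. *)
clearbody A; rewrite -(submxK A).
have -> : dlsubmx A = 0.
  apply/matrixP => i j; rewrite !mxE A1 /=; last exact: ltn_ord.
  rewrite geos_lt //; have := ltn_ord i; have := ltn_ord j; lia.
rewrite det_ublock [X in X * _]det_unitriangular ?mul1r; last 2 first.
- move=> i j ji; rewrite !mxE A1 /=; last exact: ltn_ord.
  rewrite geos_lt //; have := ltn_ord i; have := ltn_ord j; lia.
- move=> i; rewrite !mxE A1 /=; last exact: ltn_ord.
  by rewrite subnKC ?geos_diag // (leq_trans (ltnW (ltn_ord i))) // leq_addr.
congr (\det _); apply/matrixP => i j; rewrite !mxE AE /= ltnNge leq_addr /=.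
rewrite (big_cat_nat (n := d)) //=; last by lia.
rewrite big_nat big1 ?add0r; last first.
  move=> k kd; rewrite geos_lt ?mul0r //; have := ltn_ord i; lia.
rewrite -{1}[d]add0n big_addn /N /n addnCA addKn big_mkord.
apply: eq_bigr => k _.
rewrite -!(geos_addr _ _ l d) [(d + l)%N]addnC.
by congr (geos _ _ _ _ * geos _ _ _ _); have := ltn_ord i; have := ltn_ord j; lia.
Qed.

End Determinants.

(** * Passing from the variables 1 / t_q to the t_q *)

Section Inversion.
Variables (K : fieldType) (t u g : nat -> K) (l m : nat).
Hypothesis l_gt0 : (0 < l)%N.
Hypothesis tu : forall q, (q < l)%N -> t q * u q = 1.
Hypothesis t_inj : forall i j, (i < j < l)%N -> t i != t j.
Hypothesis g0 : forall e, (e < l)%N -> g e = 0.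

(* Evaluating the truncated series at [u_q = 1 / t_q] gives, up to a power of
   [t_q], a series in [t_q]; both steps cost the same Vandermonde determinant. *)
Lemma det_h_mx_inv :
  (\prod_(q < l) t q ^+ m) *
  \det (\matrix_(r < l, q < l) \sum_(k < m + l)
     g (k + (l - r)) * geos u l (delta K l) (k + (l - q))) =
  \det (\matrix_(i < l, j < l) geos t l g (m + (l - i) + j)).
Proof.
have t0 (q : 'I_l) : t q != 0.
  by apply/eqP => tq; have /eqP := tu (ltn_ord q); rewrite tq mul0r eq_sym oner_eq0.
have uE (q : 'I_l) : u q = (t q)^-1.
  by apply: (mulfI (t0 q)); rewrite mulfV // tu.
set C := \matrix_(_, _) _; set F := \matrix_(_, _) _.
pose D k : 'M[K]_l := diag_mx (\row_q t q ^+ k).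
have detD k : \det (D k) = \prod_(q < l) t q ^+ k.
  by rewrite det_diag; apply: eq_bigr => q _; rewrite mxE.
(* Rescaling by a power of [t q] turns u_q^k into a power of [t q] with complementary exponent,
   whence this reversal of columns. *)
pose rho : 'M[K]_l := \matrix_(i, j) (i == rev_ord j)%:R.
have mul_rho (B : 'M[K]_l) i j : (B *m rho) i j = B i (rev_ord j).
  rewrite mxE (bigD1 (rev_ord j)) //= mxE eqxx mulr1 big1 ?addr0 // => k kj.
  by rewrite mxE (negbTE kj) mulr0.
have E1 : C *m (comp_mx u l)^T *m D (m + l).-1 = F *m (comp_mx t l *m rho)^T.
  apply/matrixP => r q; rewrite mul_mx_diag !mxE.
  transitivity (geo (t q) g ((m + l).-1 + (l - r))); last first.
    rewrite comp_mxP; last by have := ltn_ord r; lia.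
    rewrite (reindex_inj rev_ord_inj); apply: eq_bigr => j _.
    rewrite [(_^T) _ _]mxE mul_rho !mxE mulrC; congr (geos _ _ _ _ * _) => /=.
    have := ltn_ord r; have := ltn_ord j; lia.
  transitivity (\sum_(k < m + l) g (k + (l - r)) * t q ^+ ((m + l).-1 - k)).
    rewrite mulr_suml.
    transitivity (\sum_(k < m + l) g (k + (l - r)) * u q ^+ k * t q ^+ (m + l).-1);
      last first.
      apply: eq_bigr => k _; rewrite -mulrA; congr (_ * _).
      have -> : (m + l).-1 = (k + ((m + l).-1 - k))%N by have := ltn_ord k; lia.
      by rewrite exprD mulrA uE -exprMn mulVf // expr1n mul1r addKn.
    rewrite -!mulr_suml; congr (_ * _).
    transitivity (\sum_(j < l) \sum_(k < m + l) g (k + (l - r)) *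
        (geos u l (delta K l) (k + (l - j)) * comp_mx u l q j)).
      apply: eq_bigr => j _; rewrite !mxE mulr_suml; apply: eq_bigr => k _.
      by rewrite mulrA.
    rewrite exchange_big /=; apply: eq_bigr => k _; rewrite -mulr_sumr; congr (_ * _).
    rewrite -(geo_delta _ l) comp_mxP; last by rewrite leqW // leq_addl.
    by apply: eq_bigr => j _; rewrite mulrC addnBA // ltnW.
  rewrite geo_sum -(big_mkord predT (fun k => g (k + (l - r)) * t q ^+ ((m + l).-1 - k))).
  rewrite -(big_mkord predT (fun k => t q ^+ ((m + l).-1 + (l - r) - k) * g k)).
  rewrite [RHS](big_cat_nat (n := l - r)) //=; last by lia.
  (* The first [l - r] terms vanish by [g0]; exactly the [m + l] terms of the truncated series
     remain. *)
  rewrite [X in _ = X + _]big_nat [X in _ = X + _]big1 ?add0r; last first.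
    by move=> k /andP[_ kl]; rewrite g0 ?mulr0 // (leq_trans kl) // leq_subr.
  rewrite -{2}[(l - r)%N]add0n big_addn -addSn addnK.
  have -> : (m + l).-1.+1 = (m + l)%N by have := ltn_ord r; lia.
  by apply: eq_bigr => k _; rewrite mulrC subnDr.
(* The two Vandermonde matrices are related in the same way: t_q^(l-1) u_q^k = t_q^(l-1-k). *)
have E2 : D l.-1 *m pow_mx u l l = pow_mx t l l *m rho.
  apply/matrixP => q k; rewrite mul_diag_mx mul_rho !mxE /=.
  have -> : l.-1 = (l - k.+1 + k)%N by have := ltn_ord k; lia.
  by rewrite uE exprD -mulrA -exprMn mulfV // expr1n mulr1.
(* The [t q] are distinct and [rho] is an involution, so this determinant can be cancelled. *)
have nz : \det (comp_mx t l *m rho) != 0.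
  rewrite det_mulmx mulf_neq0 //.
    rewrite det_comp_mx det_pow_mx; apply/prodf_neq0 => i _; apply/prodf_neq0 => j ij.
    by rewrite subr_eq0 eq_sym t_inj // ij ltn_ord.
  have : \det (rho *m rho) = 1.
    rewrite -(det1 _ l); congr (\det _); apply/matrixP => i j.
    by rewrite mul_rho !mxE rev_ordK.
  by rewrite det_mulmx => /eqP; apply: contraTN => /eqP ->; rewrite mul0r eq_sym oner_eq0.
have := congr1 determinant E1; have := congr1 determinant E2.
rewrite !det_mulmx !det_tr det_mulmx !det_comp_mx in nz * => e2 e1.
apply: (mulIf nz); rewrite -e1 -e2 !detD !prodrXl.
have -> : (m + l).-1 = (m + l.-1)%N by lia.
by rewrite exprD; ring.
Qed.

End Inversion.

(** * Sums over chains of partitions *)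

Section ChainSum.
Variables (R : comNzRingType) (l m : nat).

Definition set_row (A : 'M[R]_l) i0 (v : 'I_l -> R) : 'M[R]_l :=
  \matrix_(i, j) if i == i0 then v j else A i j.

Lemma det_set_row A i0 v :
  \det (set_row A i0 v) = \sum_j v j * cofactor A i0 j.
Proof.
rewrite (expand_det_row _ i0); apply: eq_bigr => j _; rewrite mxE eqxx.
congr (_ * (_ * \det _)); apply/matrixP => i k.
by rewrite !mxE eq_sym (negbTE (neq_lift _ _)).
Qed.

Definition upd (nu : {ffun 'I_l -> 'I_m.+1}) s a : {ffun 'I_l -> 'I_m.+1} :=
  [ffun i => if i == s then a else nu i].

Definition decr (nu : {ffun 'I_l -> 'I_m.+1}) : bool :=
  [forall i : 'I_l, forall j : 'I_l, (i <= j)%N ==> (nu j <= nu i)%N].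

Definition below (la : nat -> nat) (nu : {ffun 'I_l -> 'I_m.+1}) : bool :=
  [forall i : 'I_l, nu i <= la i]%N.

Variables (u : nat -> nat -> 'I_l -> R) (psi : nat -> nat -> R).
Variables (w : nat -> 'I_l -> R) (la : nat -> nat).
Hypothesis la_le : forall i, (la i <= m)%N.
Hypothesis la_decr : forall i, (la i.+1 <= la i)%N.
Hypothesis row_sum : forall i b, (i.+1 < l)%N -> (b <= la i.+1)%N ->
  exists c, forall j,
    \sum_(b <= a < (la i).+1) psi i a * u i a j = w i j + c * u i.+1 b j.
Hypothesis last_row_sum : forall i j, i.+1 = l ->
  \sum_(0 <= a < (la i).+1) psi i a * u i a j = w i j.

(** The summation range once the parts before [s] are summed out: these are frozen at [0], the
    others still decrease and lie below [la]. *)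
Let P s (nu : {ffun 'I_l -> 'I_m.+1}) :=
  [forall i : 'I_l, if (i < s)%N then nu i == ord0 else (nu i <= la i)%N] &&
  [forall i : 'I_l, forall j : 'I_l, (s <= i <= j)%N ==> (nu j <= nu i)%N].

Let M s (nu : {ffun 'I_l -> 'I_m.+1}) : 'M[R]_l :=
  \matrix_(i, j) if (i < s)%N then w i j else u i (nu i) j.

Let D s := \sum_(nu | P s nu)
  (\prod_(i < l | (s <= i)%N) psi i (nu i)) * \det (M s nu).

(** Part [s] occurs only in row [s] and in its own weight, so linearity in that row lets the sum
    over it be taken inside the determinant. *)
Let D_succ (s : 'I_l) : D s = D s.+1.
Proof.
rewrite /D (partition_big (fun nu => upd nu s ord0) (P s.+1)) /=; last first.
  move=> nu /andP[/forallP nu1 /forallP nu2]; apply/andP; split; apply/forallP => i.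
    rewrite ffunE; have := nu1 i; rewrite ltnS -[i == s]val_eqE /=.
    by case: (ltngtP i s) => // ->.
  apply/forallP => j; apply/implyP => /andP[si ij]; rewrite !ffunE.
  have /forallP/(_ j) := nu2 i; rewrite ij (ltnW si) /= -!val_eqE /=.
  by rewrite !ifN //; lia.
apply: eq_bigr => mu /andP[/forallP mu1 /forallP mu2].
rewrite (reindex_onto (fun a => upd mu s a) (fun nu => nu s)) /=; last first.
  move=> nu /andP[_ /eqP <-]; apply/ffunP => i; rewrite !ffunE.
  by case: eqP => // ->.
(* The least value allowed for part [s]: the next part, or [0] in the last row. *)
pose b := if insub s.+1 is Some s1 then nat_of_ord (mu (s1 : 'I_l)) else 0%N.
have mus : mu s = ord0 by have := mu1 s; rewrite leqnn => /eqP.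
have bE (s1 : 'I_l) : s1 = s.+1 :> nat -> b = mu s1.
  move=> e; rewrite /b; case: insubP => [s2 _ e2|]; last by rewrite -e ltn_ord.
  by congr (nat_of_ord (mu _)); apply: val_inj; rewrite /= e2 e.
have condE (a : 'I_m.+1) :
  P s (upd mu s a) && (upd (upd mu s a) s ord0 == mu) && (upd mu s a s == a) =
  (b <= a < (la s).+1)%N.
  have -> : (upd (upd mu s a) s ord0 == mu).
    by apply/eqP/ffunP => i; rewrite !ffunE; case: eqP => // ->.
  rewrite [upd mu s a s]ffunE !eqxx !andbT; apply/idP/idP.
    move=> /andP[/forallP h1 /forallP h2]; apply/andP; split; last first.
      by have := h1 s; rewrite ltnn ffunE eqxx.
    rewrite /b; case: insubP => [s1 _ e|//].
    have /forallP/(_ s1) := h2 s; rewrite !ffunE eqxx e leqnn leqnSn /=.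
    by rewrite ifN // -val_eqE e; apply/eqP => /=; lia.
  move=> /andP[ba al]; apply/andP; split; apply/forallP => i.
    rewrite ffunE; have := mu1 i; rewrite ltnS -[i == s]val_eqE /=.
    by case: (ltngtP i s) => // is_ _; rewrite is_.
  apply/forallP => j; apply/implyP => /andP[si ij]; rewrite !ffunE -!val_eqE /=.
  case: (ltngtP s i) si => // [si _|si _].
    by rewrite ifN; [have /forallP/(_ j) := mu2 i; rewrite si ij | lia].
  case: (ltngtP j s) => [|sj|//]; first by lia.
  apply: leq_trans ba.
  have s1l : (s.+1 < l)%N by apply: leq_ltn_trans sj _.
  rewrite (bE (Ordinal s1l)) //.
  by have /forallP/(_ j) := mu2 (Ordinal s1l); rewrite leqnn sj.
under eq_bigl do rewrite condE.
have prodE (a : 'I_m.+1) : \prod_(i < l | (s <= i)%N) psi i (upd mu s a i) =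
    psi s a * \prod_(i < l | (s.+1 <= i)%N) psi i (mu i).
  rewrite (bigD1 s) //= ffunE eqxx; congr (_ * _).
  apply: eq_big => [i|i /andP[_ /negbTE is_]]; last by rewrite ffunE is_.
  by rewrite ltn_neqAle andbC eq_sym.
have ME (a : 'I_m.+1) : M s (upd mu s a) = set_row (M s.+1 mu) s (u s a).
  apply/matrixP => i j; rewrite !mxE ffunE ltnS -!val_eqE /=.
  by case: (ltngtP i s) => // ->.
under eq_bigr do rewrite prodE ME det_set_row.
have -> : \det (M s.+1 mu) = \sum_j w s j * cofactor (M s.+1 mu) s j.
  rewrite -det_set_row; congr (\det _); apply/matrixP => i j; rewrite !mxE.
  by case: eqP => [->|//]; rewrite ltnSn.
have [c cE] : exists c, forall j,
    \sum_(b <= a < (la s).+1) psi s a * u s a j =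
    w s j + c * (if insub s.+1 is Some s1 then u s.+1 (mu (s1 : 'I_l)) j else 0).
  rewrite /b; case: insubP => [s1 s1l e|sl]; last first.
    exists 0 => j; rewrite mul0r addr0; apply: last_row_sum.
    by have := ltn_ord s; lia.
  apply: row_sum => //; rewrite -e.
  by have := mu1 s1; rewrite ifN // ltnS -ltnNge; apply: eq_leq.
transitivity (\prod_(i < l | (s < i)%N) psi i (mu i) *
    \sum_j (\sum_(b <= a < (la s).+1) psi s a * u s a j) * cofactor (M s.+1 mu) s j).
  rewrite (eq_bigr _ (fun j _ => mulr_suml _ _ _ _)) exchange_big /=
    mulr_sumr (@big_nat_widen _ _ _ _ _ m.+1) ?ltnS //.
  rewrite big_geq_mkord; apply: eq_big => [a|a _]; first by rewrite andbC.
  rewrite !mulr_sumr; apply: eq_bigr => j _; ring.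
congr (_ * _).
transitivity (\sum_j w s j * cofactor (M s.+1 mu) s j + c * \det (set_row (M s.+1 mu) s
    (fun j => if insub s.+1 is Some s1 then u s.+1 (mu (s1 : 'I_l)) j else 0))).
  rewrite det_set_row mulr_sumr -big_split /=; apply: eq_bigr => j _.
  by rewrite cE mulrDl mulrA.
(* Row [s.+1] of [M s.+1 mu] is not yet summed, so the error determinant has two equal rows. *)
case: insubP => [s1 s1l e|_].
  rewrite (determinant_alternate (i1 := s) (i2 := s1)) ?mulr0 ?addr0 //.
    by rewrite -val_eqE e; apply/eqP => /=; lia.
  move=> j; rewrite !mxE eqxx ifN; last by rewrite -val_eqE e; apply/eqP => /=; lia.
  by rewrite ifN -?e // -leqNgt.
rewrite det_set_row [X in c * X]big1 ?mulr0 ?addr0 // => j _; exact: mul0r.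
Qed.

(* Summing over [nu 0] first, then [nu 1], and so on, the error term of each
   partial sum is a multiple of the next row, hence does not contribute. *)
Lemma chain_sum_det :
  \sum_(nu : {ffun 'I_l -> 'I_m.+1} | decr nu && below la nu)
    (\prod_(i < l) psi i (nu i)) * \det (\matrix_(i, j) u i (nu i) j) =
  \det (\matrix_(i < l, j < l) w i j).
Proof.
have D0 s : (s <= l)%N -> D 0 = D s.
  by elim: s => // s IH sl; rewrite IH 1?ltnW // (D_succ (Ordinal sl)).
transitivity (D 0).
  apply: eq_big => [nu|nu _].
    rewrite /P /decr /below andbC; congr (_ && _).
  by congr (_ * \det _); apply/matrixP => i j; rewrite !mxE.
(* After [l] steps only the zero chain remains, with all rows given by [w]. *)
rewrite (D0 l) // /D (big_pred1 [ffun => ord0]) => [|nu].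
  rewrite big_pred0 ?mul1r; last by move=> i; rewrite leqNgt ltn_ord.
  by congr (\det _); apply/matrixP => i j; rewrite !mxE ltn_ord.
rewrite /P; apply/andP/eqP => [[/forallP h _]|->].
  by apply/ffunP => i; have := h i; rewrite ltn_ord ffunE => /eqP.
split; apply/forallP => i; first by rewrite ltn_ord ffunE.
by apply/forallP => j; rewrite leqNgt ltn_ord.
Qed.

End ChainSum.

(** * One step of the Jacobi-Trudi recursion *)

Section JacobiTrudiStep.
Variables (R : comNzRingType) (l m : nat).
Variables (t : nat -> R) (x : R) (g : nat -> R) (la : nat -> nat).
Hypothesis la_le : forall i, (la i <= m)%N.
Hypothesis la_decr : forall i, (la i.+1 <= la i)%N.
Hypothesis la_l : la l = 0%N.
Hypothesis g0 : forall e, (e < l)%N -> g e = 0.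

(** A window of the convolution defining [geo]: the terms before the window add up to a power of [y]
    times an earlier value. The offset [o.+1] keeps that index in [nat]. *)
Lemma geo_window (y : R) (f : nat -> R) o b c : (b <= c.+1)%N ->
  \sum_(b <= a < c.+1) y ^+ (c - a) * f (a + o.+1)%N =
  geo y f (c + o.+1) - y ^+ (c.+1 - b) * geo y f (b + o).
Proof.
elim: c => [|c IH]; rewrite leq_eqVlt => /predU1P[-> | bc].
- by rewrite big_geq // subnn mul1r add1n add0n subrr.
- by case: b bc => // _; rewrite big_nat1 /= mul1r expr1 addrK.
- have -> : (c.+2 + o = c.+1 + o.+1)%N by lia.
  by rewrite big_geq // subnn mul1r subrr.
rewrite big_nat_recr //= subnn mul1r.
under eq_big_nat => a /andP[_ ac] do rewrite subSn // exprS -mulrA.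
by rewrite -mulr_sumr IH // [(c.+2 - b)%N]subSn // [_ ^+ _.+1]exprS /=; ring.
Qed.

(* The weight of the part of row [i] of [la / nu] when this skew shape is filled
   with a single new entry of variable [x], [a] being the [i]-th part of [nu]. *)
Definition strip_weight i a : R :=
  t i ^+ (la i.+1 - a) * x ^+ (la i - maxn (la i.+1) a).

(* The summed [i]-th row is the expected one plus a multiple of the expected
   [i.+1]-th one, by the partial fraction identity [geo_geo]. *)
Lemma jacobi_trudi_step :
  \sum_(nu : {ffun 'I_l -> 'I_m.+1} | decr nu && below la nu)
    (\prod_(i < l) strip_weight i (nu i)) *
      \det (\matrix_(i < l, j < l) geos t i g (nu i + (l - i) + j)) =
  \det (\matrix_(i < l, j < l) geos t i (geo x g) (la i + (l - i) + j)).
Proof.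
pose u i a (j : 'I_l) := geos t i g (a + (l - i) + j).
pose T i (j : 'I_l) := geos t i (geo x g) (la i + (l - i) + j).
pose c i := (t i - x) * x ^+ (la i - la i.+1).
pose w i j := T i j + (if (i.+1 < l)%N then c i * T i.+1 j else 0).
rewrite (@chain_sum_det R l m u strip_weight w la) //.
(* The rows [w i] arise from the rows [T i] by a unitriangular matrix. *)
- pose U : 'M[R]_l := \matrix_(i, k) if i == k then 1 else
    if k == i.+1 :> nat then c i else 0.
  transitivity (\det (U *m \matrix_(i, j) T i j)).
    congr (\det _); apply/matrixP => i j; rewrite !mxE (bigD1 i) //= !mxE eqxx mul1r.
    congr (_ + _); case: ifP => il; last first.
      rewrite big1 // => k ki; rewrite !mxE eq_sym (negbTE ki) ifN ?mul0r //.
      by apply: contraFN il => /eqP <-.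
    rewrite (bigD1 (Ordinal il)) /=; last by rewrite -val_eqE /=; lia.
    rewrite !mxE /= eqxx ifN; last by rewrite -val_eqE /=; lia.
    rewrite big1 ?addr0 // => k /andP[ki ks]; rewrite !mxE eq_sym (negbTE ki) ifN ?mul0r //.
  rewrite det_mulmx [X in X * _]det_unitriangular ?mul1r // => [i j ji|i].
    by rewrite !mxE -val_eqE /= !ifN //; lia.
  by rewrite mxE eqxx.
(* The witness is the coefficient of the boundary term at [b]. The range is split at [la i.+1]:
   below it only the power of [t i] varies, above it only that of [x]. *)
- move=> i b il bla; exists (- (x ^+ (la i - la i.+1) * t i ^+ ((la i.+1).+1 - b))) => j.
  set o := (l - i.+1 + j)%N.
  have oE a : (a + (l - i) + j = a + o.+1)%N by rewrite /o; lia.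
  rewrite /w il /u /T !oE -!addnA -/o.
  rewrite (big_cat_nat (n := la i.+1)) //=; last by rewrite leqW.
  have -> : \sum_(la i.+1 <= a < (la i).+1) strip_weight i a * u i a j =
      geo x (geos t i g) (la i + o.+1)
        - x ^+ ((la i).+1 - la i.+1) * geo x (geos t i g) (la i.+1 + o).
    rewrite -geo_window ?leqW //; apply: eq_big_nat => a /andP[la_a _].
    by rewrite /strip_weight /u oE (eqP la_a) mul1r (maxn_idPr la_a).
  have -> : \sum_(b <= a < la i.+1) strip_weight i a * u i a j =
      x ^+ (la i - la i.+1) * (t i * geo (t i) (geos t i g) (la i.+1 + o)
         - t i ^+ ((la i.+1).+1 - b) * geo (t i) (geos t i g) (b + o)).
    transitivity (x ^+ (la i - la i.+1) * (\sum_(b <= a < (la i.+1).+1)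
        t i ^+ (la i.+1 - a) * geos t i g (a + o.+1) - geos t i g (la i.+1 + o.+1))).
      rewrite big_nat_recr //= subnn mul1r addrK mulr_sumr.
      apply: eq_big_nat => a /andP[_ a_la].
      by rewrite /strip_weight /u oE (maxn_idPl (ltnW a_la)); ring.
    by rewrite geo_window ?leqW // addnS /=; ring.
  rewrite -geo_geos /geos /= -!/(geos _ _ _).
  rewrite (eq_geo _ (fsym (geo_geos _ _ _ _))) /c !subSn // !exprS.
  (* The two boundary terms at [la i.+1] combine into [c i * T i.+1 j]. *)
  have := geo_geo (t i) x (geos t i g) (la i.+1 + o) => E.
  rewrite [X in _ = _ + X + _]mulrAC E; ring.
- move=> i j il; rewrite /w ifN ?addr0 /T; last by rewrite il ltnn.
  have oE a : (a + (l - i) + j = a + j.+1)%N by lia.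
  transitivity (geo x (geos t i g) (la i + j.+1)); last by rewrite oE geo_geos.
  (* The window starts at [0]; its boundary term has degree [j < l], where everything vanishes by
     [g0]. *)
  have := @geo_window x (geos t i g) j 0 (la i) (leq0n _).
  rewrite add0n [geo _ _ j](geo_vanish x (geos_vanish t i g0)) // mulr0 subr0 => <-.
  apply: eq_big_nat => a _.
  by rewrite /strip_weight /u oE il la_l mul1r max0n.
Qed.

End JacobiTrudiStep.

(** * Fillings of a rectangle *)

Lemma card_set_sum (T : finType) (P : pred T) : #|[set c | P c]| = (\sum_c P c)%N.
Proof. by rewrite -sum1dep_card big_mkcond. Qed.

Lemma sum_ord_interval m a b : (b <= m)%N ->
  (\sum_(c < m) (a <= c < b))%N = (b - a)%N.
Proof.
move=> bm; rewrite -big_mkcond /=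
  (eq_bigl (fun c : 'I_m => (c < b) && (a <= c))%N); last first.
  by move=> c; rewrite andbC.
rewrite -(@big_geq_mkord _ _ _ a m (fun c => c < b)%N (fun _ => 1%N)).
by rewrite -(@big_nat_widen _ _ _ _ _ _ predT) // sum_nat_const_nat muln1.
Qed.

(** A downward closed set of columns is an initial segment; this turns the small entries of a row
    into a part of a partition. *)
Lemma card_initial m (p : pred 'I_m) :
  (forall c c' : 'I_m, (c <= c')%N -> p c' -> p c) ->
  forall c, p c = (c < #|[set c | p c]|)%N.
Proof.
move=> pd c; have cardlt k : (k <= m)%N -> #|[set c' : 'I_m | (c' < k)%N]| = k.
  by move=> km; rewrite card_set_sum (@sum_ord_interval m 0) // subn0.
case: (boolP (p c)) => [pc|npc]; symmetry.
  rewrite -(cardlt c.+1) // subset_leq_card //; apply/subsetP => c'.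
  by rewrite !inE ltnS => cc'; apply: pd pc.
apply/negbTE; rewrite -leqNgt -[X in (_ <= X)%N](cardlt c (ltnW (ltn_ord c))).
apply: subset_leq_card; apply/subsetP => c'; rewrite !inE => pc'; rewrite ltnNge.
by apply: contra npc => cc'; apply: pd pc'.
Qed.

Section Fillings.
Variables (R : comNzRingType) (l m n : nat) (x t : nat -> R).
Local Notation filling := {ffun 'I_l * 'I_m -> 'I_n.+1}.
Local Notation shape := {ffun 'I_l -> 'I_m.+1}.
Implicit Types (f g : filling) (nu la : shape).

Definition mono f : bool :=
  [forall p : 'I_l * 'I_m, forall q : 'I_l * 'I_m,
    ((p.1 <= q.1)%N && (p.2 <= q.2)%N) ==> (f p <= f q)%N].

Definition region k nu f : bool :=
  [forall p : 'I_l * 'I_m, if (p.2 < nu p.1)%N then (f p < k)%N else f p == ord_max].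

(* A reverse plane partition of shape [nu] with entries below [k], extended by
   the value [n] to the whole rectangle. *)
Definition fill k nu f := mono f && region k nu f.

Definition wt_a f (i : nat) : nat := #|[set c | [exists r, f (r, c) == i :> nat]]|.

(** Columns stand for the boxes of row [r]; the condition [f (p, c) < n] discards equal fillers
    outside the shape. *)
Definition wt_b f (r : nat) : nat :=
  #|[set c | [exists p : 'I_l, exists q : 'I_l,
      [&& p == r :> nat, q == r.+1 :> nat, f (p, c) == f (q, c) & f (p, c) < n]%N]]|.

Definition fill_sum k nu : R := \sum_(f | fill k nu f)
  (\prod_(r < l.-1) t r ^+ wt_b f r) * (\prod_(i < n) x i ^+ wt_a f i).

Definition ext nu (i : nat) : nat := oapp (fun j => nat_of_ord (nu j)) 0%N (insub i).

Lemma extE nu (i : 'I_l) : ext nu i = nu i.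
Proof. by rewrite /ext valK. Qed.

Lemma ext_le nu i : (ext nu i <= m)%N.
Proof. by rewrite /ext; case: insubP => //= j _ _; rewrite -ltnS. Qed.

Lemma ext_out nu i : (l <= i)%N -> ext nu i = 0%N.
Proof. by rewrite /ext; case: insubP => //= j; rewrite ltnNge => /negbTE ->. Qed.

Lemma decrP nu : reflect (forall i j : 'I_l, (i <= j)%N -> (nu j <= nu i)%N) (decr nu).
Proof.
apply: (iffP forallP) => [h i j ij|h i]; last first.
  by apply/forallP => j; apply/implyP/h.
by have /forallP/(_ j)/implyP := h i; apply.
Qed.

Lemma ext_decr nu i : decr nu -> (ext nu i.+1 <= ext nu i)%N.
Proof.
move=> /decrP nud; case: (ltnP i.+1 l) => [il|]; last by move/ext_out ->.
rewrite (extE nu (Ordinal il)) (extE nu (Ordinal (ltnW il))); exact: nud.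
Qed.

Lemma monoP f :
  reflect (forall p q : 'I_l * 'I_m,
    (p.1 <= q.1)%N -> (p.2 <= q.2)%N -> (f p <= f q)%N) (mono f).
Proof.
apply: (iffP forallP) => [h p q pq1 pq2|h p].
  by have /forallP/(_ q) := h p; rewrite pq1 pq2.
by apply/forallP => q; apply/implyP => /andP[]; apply: h.
Qed.

Lemma regionP k nu f :
  reflect (forall p : 'I_l * 'I_m,
    if (p.2 < nu p.1)%N then (f p < k)%N else f p == ord_max)
  (region k nu f).
Proof. exact: forallP. Qed.

Definition shp k f : shape := [ffun r => inord #|[set c | (f (r, c) < k)%N]|].

Lemma shpE k f r : shp k f r = #|[set c | (f (r, c) < k)%N]| :> nat.
Proof. by rewrite ffunE inordK // ltnS -[X in (_ <= X)%N]card_ord max_card. Qed.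

Lemma mono_shp k f p : mono f -> (f p < k)%N = (p.2 < shp k f p.1)%N.
Proof.
case: p => r c /monoP fm; rewrite shpE /=.
apply: (@card_initial m (fun c => f (r, c) < k)%N) => c1 c2 c12; apply: leq_ltn_trans.
exact: fm.
Qed.

(** Together with [shp], [strip] is inverse to [add_strip]: a filling of [la] with entries at most
    [k] amounts to an inner shape [nu] and a filling of it with entries below [k]. *)
Definition strip (k : nat) f : filling :=
  [ffun p : 'I_l * 'I_m => if (f p < k)%N then f p else ord_max].

Definition add_strip (k : nat) nu la f : filling :=
  [ffun p : 'I_l * 'I_m => if (p.2 < nu p.1)%N then f p
             else if (p.2 < la p.1)%N then inord k else ord_max].

Lemma fill_strip k la f : fill k.+1 la f -> fill k (shp k f) (strip k f).
Proof.
move=> /andP[fm /regionP fr]; apply/andP; split.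
  apply/monoP => p q pq1 pq2; rewrite !ffunE; have := monoP _ fm p q pq1 pq2.
  case: ifP => pk; case: ifP => qk //= pq; first by rewrite -ltnS.
  by have := leq_ltn_trans pq qk; rewrite pk.
by apply/regionP => p; rewrite -mono_shp // ffunE; case: ifP => fpk; rewrite fpk.
Qed.

Section Strip.
Variables (k : nat) (la : shape).
Hypotheses (kn : (k < n)%N) (lad : decr la).

Lemma shp_below f : fill k.+1 la f -> decr (shp k f) && below (ext la) (shp k f).
Proof.
move=> /andP[fm /regionP fr]; apply/andP; split.
  apply/decrP => i j ij; rewrite !shpE subset_leq_card //; apply/subsetP => c.
  by rewrite !inE; apply: leq_ltn_trans; apply: (monoP _ fm).
apply/forallP => r; rewrite extE leqNgt; apply/negP => rla.
have cm : (la r < m)%N by apply: leq_trans rla _; rewrite -ltnS.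
have := fr (r, Ordinal cm); rewrite /= ltnn => /eqP E.
have := mono_shp k (r, Ordinal cm) fm; rewrite /= rla E /= => H.
by have := ltn_trans H kn; rewrite ltnn.
Qed.

Lemma strip_add f : fill k.+1 la f -> add_strip k (shp k f) la (strip k f) = f.
Proof.
move=> /andP[fm /regionP fr]; apply/ffunP => p; rewrite ffunE -mono_shp // ffunE.
case: ifP => [fpk|fpk]; rewrite ?fpk //; have := fr p; case: ifP => _; last by move/eqP.
move=> fpk1; apply: val_inj; rewrite /= inordK ?ltnS 1?ltnW //.
by have := negbT fpk; lia.
Qed.

Variable nu : shape.
Hypotheses (nud : decr nu) (nula : below (ext la) nu).

Let nu_la r : (nu r <= la r)%N.
Proof. by have /forallP/(_ r) := nula; rewrite extE. Qed.

Let inordk : (inord k : 'I_n.+1) = k :> nat.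
Proof. by rewrite inordK // ltnS ltnW. Qed.

Lemma fill_add f : fill k nu f -> fill k.+1 la (add_strip k nu la f).
Proof.
move=> /andP[fm /regionP fr]; apply/andP; split.
  apply/monoP => -[pr pc] [qr qc] /= rr cc; rewrite !ffunE /=.
  have := fr (pr, pc); have := fr (qr, qc) => /=.
  have := decrP _ nud _ _ rr; have := decrP _ lad _ _ rr.
  case: (ltnP qc (nu qr)) => hq lal nul.
    by rewrite (leq_ltn_trans cc (leq_trans hq nul)) => _ _; apply: (monoP _ fm).
  case: (ltnP qc (la qr)) => hq' _; last by move=> _; rewrite -ltnS.
  rewrite (leq_ltn_trans cc (leq_trans hq' lal)).
  by case: ifP => // _; rewrite inordk; apply: ltnW.
apply/regionP => p; rewrite ffunE; have := fr p; have := nu_la p.1.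
case: (ltnP p.2 (nu p.1)) => pn; case: (ltnP p.2 (la p.1)) => pl nul.
- exact: leqW.
- by have := leq_trans pn nul; rewrite ltnNge pl.
- by rewrite inordk ltnSn.
- by rewrite eqxx.
Qed.

Lemma shp_add f : fill k nu f -> shp k (add_strip k nu la f) = nu.
Proof.
move=> fnu; have /andP[am _] := fill_add fnu; case/andP: fnu => fm /regionP fr.
apply/ffunP => r; apply: val_inj; rewrite /= shpE.
transitivity #|[set c : 'I_m | (0 <= c < nu r)%N]|; last first.
  by rewrite card_set_sum sum_ord_interval ?subn0 // -ltnS.
congr #|pred_of_set _|; apply/setP => c; rewrite !inE ffunE /=; have := fr (r, c) => /=.
case: ifP => // _ _; case: ifP => _ /=; first by rewrite inordk ltnn.
by rewrite ltnNge ltnW.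
Qed.

Lemma add_stripK f : fill k nu f -> strip k (add_strip k nu la f) = f.
Proof.
move=> /andP[fm /regionP fr]; apply/ffunP => p; rewrite !ffunE; have := fr p.
case: (ltnP p.2 (nu p.1)) => [_ -> //|_ /eqP ->].
by case: (ltnP p.2 (la p.1)) => _; rewrite ?if_same // inordk ltnn.
Qed.

Lemma wt_a_add f i : fill k nu f -> (i < n)%N -> i != k ->
  wt_a (add_strip k nu la f) i = wt_a f i.
Proof.
move=> /andP[fm /regionP fr] il ik; congr #|pred_of_set _|; apply/setP => c; rewrite !inE.
apply: eq_existsb => r; rewrite ffunE; have := fr (r, c) => /=; case: ifP => // _ /eqP ->.
case: ifP => _ //=; rewrite inordk eq_sym (negbTE ik); apply/esym/negbTE.
by rewrite neq_ltn il orbT.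
Qed.

Lemma wt_a_k f : fill k nu f -> wt_a f k = 0%N.
Proof.
move=> /andP[fm /regionP fr]; apply/eqP; rewrite cards_eq0; apply/eqP/setP => c.
rewrite !inE; apply/negbTE/existsPn => r; have := fr (r, c) => /=; case: ifP => _.
  by rewrite neq_ltn => ->.
by move=> /eqP -> /=; rewrite neq_ltn kn orbT.
Qed.

(** A column containing [k] is counted in the lowest row where it meets [la]; column [c] has lowest
    row [r] when it lies between [la r.+1] and [la r]. *)
Lemma wt_a_add_k f : fill k nu f -> wt_a (add_strip k nu la f) k =
  (\sum_(r < l) (ext la r - maxn (ext la r.+1) (nu r)))%N.
Proof.
move=> /andP[fm /regionP fr].
transitivity (\sum_(c < m) \sum_(r < l) (maxn (ext la r.+1) (nu r) <= c < ext la r))%N;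
  last first.
  rewrite exchange_big; apply: eq_bigr => r _; apply: sum_ord_interval; exact: ext_le.
rewrite /wt_a card_set_sum; apply: eq_bigr => c _.
have addE r : (add_strip k nu la f (r, c) == k :> nat) = (nu r <= c < la r)%N.
  rewrite ffunE /=; have := fr (r, c) => /=.
  case: (ltnP c (nu r)) => /= _; first by move=> fk; apply/negbTE; rewrite neq_ltn fk.
  move=> _; case: (ltnP c (la r)) => _ /=; first by rewrite inordk eqxx.
  by apply/negbTE; rewrite neq_ltn kn orbT.
under eq_existsb do rewrite addE.
case: existsP => [[r1 /andP[r1n r1l]]|nex]; last first.
  rewrite big1 // => r _; apply/eqP; rewrite eqb0; apply/negP => /andP[].
  by rewrite geq_max extE => /andP[_ a] b; case: nex; exists r; rewrite a b.
case: (@arg_maxnP _ r1 (fun r => c < la r)%N val r1l) => r0 r0l r0max.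
have r01 := r0max _ r1l.
rewrite (bigD1 r0) //= extE r0l geq_max (leq_trans (decrP _ nud _ _ r01) r1n) !andbT.
have -> : (ext la r0.+1 <= c)%N.
  rewrite leqNgt /ext; case: insubP => //= s _ sE; apply/negP => cs.
  by have := r0max _ cs; rewrite /= sE ltnn.
rewrite big1 // => r rr0; apply/eqP; rewrite eqb0; apply/negP => /andP[].
rewrite geq_max extE => /andP[a _] b; have := r0max _ b; rewrite /= leq_eqVlt.
move=> /orP[/eqP /val_inj e|rlt]; first by rewrite e eqxx in rr0.
have rl : (r.+1 < l)%N by apply: leq_ltn_trans rlt _.
have := leq_trans r0l (decrP _ lad (Ordinal rl) r0 rlt).
by rewrite ltnNge -extE a.
Qed.

(** An old entry never equals a new one, so the new coincidences are the columns of row [r] outside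
    [nu] whose next box is still in [la]. *)
Lemma wt_b_add f r : fill k nu f -> (r < l.-1)%N ->
  wt_b (add_strip k nu la f) r = (wt_b f r + (ext la r.+1 - ext nu r))%N.
Proof.
move=> /andP[fm /regionP fr] rl.
have ql : (r.+1 < l)%N by lia.
pose q := Ordinal ql; pose p := Ordinal (ltnW ql).
have exE (P : 'I_l -> 'I_l -> bool) :
    [exists p : 'I_l, exists q : 'I_l, [&& p == r :> nat, q == r.+1 :> nat & P p q]] = P p q.
  apply/existsP/idP => [[p' /existsP[q' /and3P[/eqP ep /eqP eq Pp]]]|Ppq].
    by have -> : p = p' by [apply: val_inj]; have -> : q = q' by apply: val_inj.
  by exists p; apply/existsP; exists q; rewrite !eqxx.
rewrite -(sum_ord_interval (ext nu r) (ext_le la r.+1)).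
rewrite /wt_b !card_set_sum -big_split /=; apply: eq_bigr => c _; rewrite !exE.
rewrite (extE la q) (extE nu p) !ffunE /=.
have := fr (p, c); have := fr (q, c) => /=.
have pq : (p <= q)%N by [].
have := decrP _ nud _ _ pq; have := decrP _ lad _ _ pq => lapq nupq.
case: (ltnP c (nu p)) => cp; case: (ltnP c (nu q)) => cq.
- by rewrite addn0.
- move=> /eqP -> fpk; rewrite addn0.
  have -> : (f (p, c) == ord_max) = false.
    by apply/negbTE; rewrite -val_eqE /= neq_ltn (ltn_trans fpk kn).
  case: ifP => _; last by rewrite -val_eqE /= [_ == _]ltn_eqF // (ltn_trans fpk kn).
  by rewrite -val_eqE /= inordk ltn_eqF.
- by have := leq_trans cq nupq; rewrite ltnNge cp.
move=> /eqP -> /eqP ->; rewrite eqxx /= ltnn add0n.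
case: (ltnP c (la q)) => cl; first by rewrite (leq_trans cl lapq) eqxx inordk kn.
case: ifP => _; last by rewrite /= ltnn andbF.
by rewrite -val_eqE /= inordk ltn_eqF.
Qed.

End Strip.

(* Removing the boxes with the largest entry [k]. *)
Lemma fill_sum_rec k la : (k < n)%N -> decr la ->
  fill_sum k.+1 la = \sum_(nu : shape | decr nu && below (ext la) nu)
    (\prod_(i < l) strip_weight t (x k) (ext la) i (nu i)) * fill_sum k nu.
Proof.
move=> kn lad; rewrite /fill_sum.
rewrite (partition_big (shp k) (fun nu => decr nu && below (ext la) nu)) /=;
  last exact: shp_below.
apply: eq_bigr => nu /andP[nud nula].
rewrite (reindex_onto (add_strip k nu la) (strip k)) /=; last first.
  by move=> f /andP[ff /eqP <-]; apply: strip_add.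
rewrite mulr_sumr; apply: eq_big => [f|f].
  apply/idP/idP => [/andP[/andP[/fill_strip ff /eqP s1] /eqP s2]|ff].
    by rewrite s1 s2 in ff.
  by rewrite fill_add // shp_add // add_stripK // !eqxx.
rewrite -andbA => /and3P[/fill_strip ff /eqP s1 /eqP s2]; rewrite s1 s2 {s1 s2} in ff.
have -> : \prod_(i < n) x i ^+ wt_a (add_strip k nu la f) i =
    x k ^+ (\sum_(r < l) (ext la r - maxn (ext la r.+1) (nu r)))%N *
    \prod_(i < n) x i ^+ wt_a f i.
  rewrite (bigD1 (Ordinal kn)) //= [in RHS](bigD1 (Ordinal kn)) //=
    (wt_a_add_k kn lad nud) // (wt_a_k kn ff) mul1r.
  congr (_ * _); apply: eq_bigr => i ik; by rewrite wt_a_add.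
have -> : \prod_(r < l.-1) t r ^+ wt_b (add_strip k nu la f) r =
    (\prod_(i < l) t i ^+ (ext la i.+1 - nu i)) * \prod_(r < l.-1) t r ^+ wt_b f r.
  (* The last row contributes the factor [1], as [ext la l = 0]. *)
  have -> : \prod_(i < l) t i ^+ (ext la i.+1 - nu i) =
      \prod_(i < l.-1) t i ^+ (ext la i.+1 - ext nu i).
    rewrite (eq_bigr (fun i : 'I_l => t i ^+ (ext la i.+1 - ext nu i))) => [|i _]; last first.
      by rewrite extE.
    rewrite -!(big_mkord predT (fun i => t i ^+ (ext la i.+1 - ext nu i))).
    case: (posnP l) => [->//|lp]; rewrite -{1}(prednK lp) big_nat_recr //= ext_out ?prednK //.
    by rewrite mulr1.
  rewrite -big_split /=; apply: eq_bigr => r _.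
  by rewrite (wt_b_add kn lad nud nula ff) // addnC exprD.
rewrite /strip_weight big_split /= prodrXr; ring.
Qed.
(** With no entry available, the constant filling by [n] is the only candidate. *)
Lemma fill_sum0 nu : decr nu -> fill_sum 0 nu = [forall i, nu i == ord0]%:R.
Proof.
move=> nud; rewrite /fill_sum; case: (boolP [forall _, _]) => [/forallP n0|nn0]; last first.
  rewrite big_pred0 // => f; apply/negbTE; apply: contra nn0 => /andP[_ /regionP fr].
  apply/forallP => i; apply/eqP/val_inj/eqP => /=; rewrite -leqn0 leqNgt.
  apply/negP => ni; have m0 : (0 < m)%N by apply: leq_trans ni _; rewrite -ltnS.
  by have := fr (i, Ordinal m0); rewrite /= ni.
rewrite (big_pred1 [ffun=> ord_max]) => [|f].
  rewrite [X in X * _]big1 ?mul1r ?big1 // => i _.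
    rewrite (_ : wt_a _ i = 0%N) //; apply/eqP.
    rewrite cards_eq0; apply/eqP/setP => c; rewrite !inE; apply/negbTE/existsPn => r.
    by rewrite ffunE /= neq_ltn ltn_ord orbT.
  rewrite (_ : wt_b _ i = 0%N) //; apply/eqP.
  rewrite cards_eq0; apply/eqP/setP => c; rewrite !inE; apply/negbTE/existsPn => p.
  by apply/existsPn => q; rewrite !ffunE /= ltnn !andbF.
apply/andP/eqP => [[_ /regionP fr]|->].
  apply/ffunP => p; rewrite ffunE; have := fr p.
  by rewrite (eqP (n0 _)) /= => /eqP.
split; first by apply/monoP => p q _ _; rewrite !ffunE.
by apply/regionP => p; rewrite (eqP (n0 _)) ffunE eqxx.
Qed.

(** Both sides obey the same recursion in [k], by [fill_sum_rec] and [jacobi_trudi_step]. *)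
Lemma jacobi_trudi k nu : (k <= n)%N -> decr nu ->
  fill_sum k nu = \det (\matrix_(i < l, j < l)
    geos t i (geos x k (delta R l)) (nu i + (l - i) + j)).
Proof.
elim: k nu => [|k IH] nu kn nud.
  rewrite fill_sum0 //; case: (boolP [forall _, _]) => [/forallP n0|].
    symmetry; apply: det_unitriangular => [i j ji|i]; rewrite mxE (eqP (n0 _)) /= add0n.
      by apply: geos_lt; have := ltn_ord i; lia.
    by rewrite subnK ?geos_diag // ltnW.
  rewrite negb_forall => /existsP[i ni].
  (* The top row involves no variable at all, and its degrees [nu i0 + j] are positive: it is
     zero. *)
  pose i0 := Ordinal (leq_ltn_trans (leq0n i) (ltn_ord i)).
  rewrite (expand_det_row _ i0) big1 // => j _; rewrite mxE /=.
  have : (0 < nu i0)%N by apply: leq_trans (decrP _ nud i0 i (leq0n _)); rewrite lt0n.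
  by rewrite /delta subn0 => n0; case: eqP; rewrite ?mul0r //; lia.
rewrite fill_sum_rec //.
transitivity (\det (\matrix_(i < l, j < l)
    geos t i (geo (x k) (geos x k (delta R l))) (ext nu i + (l - i) + j))).
  rewrite -(@jacobi_trudi_step R l m).
  - apply: eq_bigr => mu /andP[mud _]; rewrite IH //; exact: ltnW.
  - exact: ext_le.
  - by move=> i; apply: ext_decr.
  - exact: ext_out.
  - by move=> e el; apply: geos_lt.
by congr (\det _); apply/matrixP => i j; rewrite !mxE extE.
Qed.

End Fillings.

(** * Reverse plane partitions as fillings *)

Section ReversePlanePartition.
Variables (R : comNzRingType) (l m n : nat) (la : l.-tuple 'I_m.+1).
Variables (x : 'I_n -> R) (t : 'I_l.-1 -> R) (xs ts : nat -> R).
Hypotheses (xE : forall i : 'I_n, xs i = x i) (tE : forall i : 'I_l.-1, ts i = t i).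

Let nu : {ffun 'I_l -> 'I_m.+1} := [ffun i => tnth la i].
Local Notation lam := (map_tuple val la).
Hypothesis nud : decr nu.

Lemma is_part_decr (mu : l.-tuple 'I_m.+1) :
  is_part (map_tuple val mu) = decr [ffun i => tnth mu i].
Proof.
apply/idP/decrP => [srt i j ij|h].
  rewrite !ffunE !(tnth_nth ord0) -!(nth_map ord0 0%N) ?size_tuple //.
  apply: (sorted_leq_nth (fun a b c ba cb => leq_trans cb ba) leqnn 0%N srt) => //;
    by rewrite inE size_map size_tuple.
apply/(sortedP 0%N) => i; rewrite size_map size_tuple => il.
rewrite !(nth_map ord0) ?size_tuple //; last exact: ltnW.
have := h (Ordinal (ltnW il)) (Ordinal il) (leqnSn _).
by rewrite !ffunE !(tnth_nth ord0).
Qed.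

Let head_le : (head 0 lam <= m)%N.
Proof. by case: la => -[|a s] //= _; rewrite -ltnS. Qed.

Let le_head i : (nu i <= head 0 lam)%N.
Proof.
have l0 : (0 < l)%N by apply: leq_ltn_trans (ltn_ord i).
have /decrP/(_ (Ordinal l0) i (leq0n _)) := nud; rewrite !ffunE => /leq_trans; apply.
rewrite (tnth_nth ord0) /= -nth0 (nth_map ord0) ?size_tuple //.
Qed.

Definition emb (b : box lam) : 'I_l * 'I_m := (brow b, widen_ord head_le (bcol b)).

Lemma emb_inj : injective emb.
Proof.
move=> b b' [e1 e2]; apply: val_inj; move: e1 e2; rewrite /brow /bcol.
by case: (val b) (val b') => [r c] [r' c'] /= -> /val_inj ->.
Qed.

Lemma emb_in b : ((emb b).2 < nu (emb b).1)%N.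
Proof. by have := valP b; rewrite tnth_map ffunE. Qed.

Lemma in_emb (p : 'I_l * 'I_m) : (p.2 < nu p.1)%N -> exists b, emb b = p.
Proof.
case: p => r c /= cr.
have ch := leq_trans cr (le_head r).
have bP : ((r, Ordinal ch).2 < tnth lam (r, Ordinal ch).1)%N.
  by rewrite tnth_map; move: cr; rewrite ffunE.
exists (Sub (r, Ordinal ch) bP : box lam).
rewrite /emb /brow /bcol SubK /=; congr (_, _); exact: val_inj.
Qed.

Definition extend (T : {ffun box lam -> 'I_n}) : {ffun 'I_l * 'I_m -> 'I_n.+1} :=
  [ffun p => if [pick b | emb b == p] is Some b
             then widen_ord (leqnSn n) (T b) else ord_max].

Lemma extend_emb T b : extend T (emb b) = T b :> nat.
Proof.
rewrite ffunE; case: pickP => [b' /eqP/emb_inj -> //|/(_ b)].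
by rewrite eqxx.
Qed.

Lemma extend_out T (p : 'I_l * 'I_m) : ~~ (p.2 < nu p.1)%N -> extend T p = ord_max.
Proof.
by move=> np; rewrite ffunE; case: pickP => // b /eqP e; rewrite -e emb_in in np.
Qed.

Lemma extend_inj : injective extend.
Proof.
move=> T T' e; apply/ffunP => b; apply: val_inj => /=.
by rewrite -!extend_emb e.
Qed.

(** The filler [n] exceeds all entries and occupies a region closed under moving right or down, so
    monotonicity extends to the rectangle. *)
Lemma fill_extend T : fill n nu (extend T) = is_rpp T.
Proof.
apply/andP/andP => [[/monoP fm _]|[/forallP h1 /forallP h2]].
  split; apply/forallP => b; apply/forallP => b'; apply/implyP => /andP[/eqP e le];
    rewrite -!extend_emb; apply: fm => //=; by rewrite e.
have {}h1 b b' : brow b = brow b' -> (bcol b <= bcol b')%N -> (T b <= T b')%N.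
  by have /forallP/(_ b')/implyP h := h1 b => e le; apply: h; rewrite e eqxx.
have {}h2 b b' : bcol b = bcol b' -> (brow b <= brow b')%N -> (T b <= T b')%N.
  by have /forallP/(_ b')/implyP h := h2 b => e le; apply: h; rewrite e eqxx.
split; last first.
  apply/regionP => p; case: ifP => [/in_emb[b <-]|/negbT/extend_out -> //].
  by rewrite extend_emb.
apply/monoP => p q pq1 pq2.
case: (boolP (q.2 < nu q.1)%N) => [qn|/extend_out ->]; last by rewrite -ltnS.
(* The comparison goes through the corner box in the row of [p] and the column of [q]. *)
have pqn : (q.2 < nu p.1)%N by apply: leq_trans qn _; apply: (decrP _ nud).
have pn := leq_ltn_trans pq2 pqn.
have [b bE] := in_emb qn;
have [b' b'E] := in_emb (pqn : ((p.1, q.2).2 < nu (p.1, q.2).1)%N).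
have [b'' b''E] := in_emb pn; rewrite -bE -b''E !extend_emb.
move: bE b'E b''E pq1 pq2; case: p q {pqn qn pn} => [pr pc] [qr qc] /=.
move=> [e1 e2] [e3 e4] [e5 e6] pq1 pq2; apply: (@leq_trans (T b')).
  by apply: h1; [rewrite e5 e3 |
    move: e4 e6 pq2 => /(congr1 val) /= -> /(congr1 val) /= ->].
apply: h2; last by rewrite e3 e1.
by apply: val_inj; move: e4 e2 => /(congr1 val) /= -> /(congr1 val) /= ->.
Qed.

Lemma fill_extend_ex f : fill n nu f -> exists T, extend T = f.
Proof.
move=> /andP[_ /regionP fr].
have fn b : (f (emb b) < n)%N by have := fr (emb b); rewrite emb_in.
exists [ffun b => Ordinal (fn b)]; apply/ffunP => p; rewrite ffunE.
case: pickP => [b /eqP <-|nb]; first by apply: val_inj; rewrite /= ffunE.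
have := fr p; case: ifP => [/in_emb[b e]|_ /eqP -> //].
by have := nb b; rewrite e eqxx.
Qed.

Lemma wt_a_extend T (i : 'I_n) : wt_a (extend T) i = rpp_a T i.
Proof.
have wi : injective (widen_ord head_le)
  by move=> a b e; apply: val_inj; exact: (congr1 val e).
rewrite /rpp_a -(card_imset _ wi).
congr #|pred_of_set _|; apply/setP => c; rewrite !inE.
apply/existsP/imsetP => [[r /eqP ei]|[c' ]].
  case: (boolP (c < nu r)%N) => [/(@in_emb (r, c))[b bE]|nc].
    exists (bcol b); last by case: bE.
    rewrite inE; apply/existsP; exists b; rewrite eqxx /= -val_eqE /= -extend_emb bE.
    exact/eqP.
  by have := ltn_ord i; rewrite -ei (@extend_out _ (r, c)) // ltnn.
rewrite inE => /existsP[b /andP[/eqP <- /eqP <-]] ->; exists (brow b).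
by rewrite -/(emb b) extend_emb.
Qed.

Lemma wt_b_extend T r : wt_b (extend T) r = rpp_b T r.
Proof.
(* Boxes of a fixed row correspond to their columns. *)
rewrite /rpp_b -(card_in_imset (f := fun b => widen_ord head_le (bcol b))); last first.
  move=> b b'; rewrite !inE => /andP[/eqP rb _] /andP[/eqP rb' _] e; apply: emb_inj.
  rewrite /emb e; congr (_, _); apply: val_inj; exact: etrans rb (esym rb').
congr #|pred_of_set _|; apply/setP => c; rewrite !inE.
apply/existsP/imsetP => [[p /existsP[q /and4P[/eqP pr /eqP qr /eqP epq pn]]]|[b]].
  have inn s : (extend T (s, c) < n)%N -> exists b, emb b = (s, c).
    move=> sn; apply: in_emb; apply: contraTT sn => /extend_out ->.
    by rewrite -leqNgt.
  have [b bE] := inn p pn; rewrite epq in pn; have [b' b'E] := inn q pn.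
  case: (bE) (b'E) => bE1 bE2 [b'E1 b'E2].
  exists b => //; rewrite inE bE1 pr eqxx; apply/existsP; exists b'.
  rewrite b'E1 qr eqxx -!val_eqE /= -!extend_emb bE b'E epq eqxx !andbT.
  by move: bE2 b'E2 => /(congr1 val) /= -> /(congr1 val) /= ->.
rewrite inE => /andP[/eqP br /existsP[b' /and3P[/eqP ec /eqP er /eqP eT]]] ->.
exists (brow b); apply/existsP; exists (brow b'); rewrite br er br !eqxx /=.
have -> : (brow b', widen_ord head_le (bcol b)) = emb b' by rewrite /emb ec.
rewrite -/(emb b) -val_eqE /= !extend_emb eT eqxx /=.
exact: ltn_ord.
Qed.

Lemma refined_g_fill_sum : refined_g lam x t = fill_sum n xs ts n nu.
Proof.
rewrite /fill_sum (reindex_omap extend (fun f => [pick T | extend T == f])); last first.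
  move=> f /fill_extend_ex[T eT]; case: pickP => [T' /= /eqP -> //|/(_ T)].
  by rewrite eT eqxx.
apply: eq_big => [T|T _].
  rewrite fill_extend; case: pickP => [T' /eqP/extend_inj ->|/(_ T)]; last by rewrite eqxx.
  by rewrite eqxx andbT.
congr (_ * _); apply: eq_bigr => i _; first by rewrite wt_b_extend tE.
by rewrite wt_a_extend xE.
Qed.

End ReversePlanePartition.

(** * The rectangular sum *)

Section RectangularSum.
Variables (R : comNzRingType) (l m : nat) (t g : nat -> R).
Hypothesis l_gt0 : (0 < l)%N.
Hypothesis g0 : forall e, (e < l)%N -> g e = 0.

(* The factors [t i ^+ (m - nu i)] are the weights of a strip filling up the
   rectangle whose variable is specialized to [t l.-1]. *)
Lemma rectangular_sum :
  \sum_(nu : {ffun 'I_l -> 'I_m.+1} | decr nu)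
    (\prod_(i < l) t i ^+ (m - nu i)) *
      \det (\matrix_(i < l, j < l) geos t i g (nu i + (l - i) + j)) =
  \det (\matrix_(i < l, j < l) geos t l g (m + (l - i) + j)).
Proof.
pose la i := if (i < l)%N then m else 0%N.
transitivity (\det (\matrix_(i < l, j < l)
    geos t i (geo (t l.-1) g) (la i + (l - i) + j))).
  rewrite -(@jacobi_trudi_step R l m) //; first last.
  - by rewrite /la ltnn.
  - by move=> i; rewrite /la; case: (ltnP i.+1 l) => // il; rewrite (ltnW il).
  - by move=> i; rewrite /la; case: ifP.
  apply: eq_big => [nu|nu _].
    suff -> : below la nu by rewrite andbT.
    by apply/forallP => i; rewrite /la ltn_ord -ltnS.
  congr (_ * _); apply: eq_bigr => i _; rewrite /strip_weight /la ltn_ord.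
  have num : (nu i <= m)%N by rewrite -ltnS.
  (* Above the last row the strip weight is a power of [t i]; in the last row it is a power of the
     strip variable, here [t l.-1]. *)
  case: ltnP => il; first by rewrite (maxn_idPl num) subnn mulr1.
  rewrite max0n mul1r; congr (t _ ^+ _); have := ltn_ord i; lia.
(* Row [i] lacks the factors of [t q] for [i <= q < l.-1]; multiplying the full series by their
   inverses combines rows [i] to [l.-1]. *)
pose U : 'M[R]_l := \matrix_(i, k)
  if (i <= k)%N then ecoef (fun q => t (i + q)%N) (l.-1 - i) (k - i) else 0.
transitivity (\det (U *m \matrix_(i < l, j < l) geos t l g (m + (l - i) + j))).
  congr (\det _); apply/matrixP => i j; rewrite !mxE /la ltn_ord.
  set y := fun q => t (i + q)%N; set s := (l.-1 - i)%N.
  have il : (i + s)%N = l.-1 by rewrite subnKC // -ltnS prednK.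
  have fullE : geos y s (geos t i (geo (t l.-1) g)) =1 geos t l g.
    by move=> e; rewrite -geos_add il -geo_geos -[in RHS](prednK l_gt0).
  rewrite (@ecoef_geos _ y s); last by lia.
  transitivity (\sum_(i <= k < l) ecoef y s (k - i) * geos t l g (m + (l - k) + j)).
    rewrite -[X in \sum_(X <= _ < _) _]add0n big_addn.
    have -> : (l - i = s.+1)%N by have := ltn_ord i; lia.
    rewrite big_mkord; apply: eq_bigr => q _; rewrite fullE addnK; congr (_ * geos _ _ _ _).
    have := ltn_ord q; lia.
  rewrite big_geq_mkord big_mkcond /=; apply: eq_bigr => k _; rewrite !mxE.
  by case: ifP => _; rewrite ?mul0r.
rewrite det_mulmx [\det U]det_unitriangular ?mul1r // => [i j ji|i]; rewrite mxE.
  by rewrite leqNgt ji.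
by rewrite leqnn subnn ecoef0.
Qed.

End RectangularSum.

(** * The determinant quotient as a polynomial *)

Section Morphism.
Variables (R S : comNzRingType) (phi : {rmorphism R -> S}).

Lemma geos_morph (y g : nat -> R) k e :
  phi (geos y k g e) = geos (phi \o y) k (phi \o g) e.
Proof.
elim: k e => // k IH e.
rewrite /geos /= -!/(geos _ _ _); elim: e => [|e IHe] /=; rewrite ?rmorphD ?rmorphM ?IH //.
by rewrite IHe.
Qed.

Lemma map_h_mx (y : nat -> R) n N : map_mx phi (h_mx y n N) = h_mx (phi \o y) n N.
Proof.
apply/matrixP => i k; rewrite !mxE geos_morph.
by apply: eq_geos => // e; rewrite /delta /= rmorph_nat.
Qed.

End Morphism.

Lemma h_mx_eq (R : comNzRingType) (y z : nat -> R) n N :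
  (forall i, (i < n)%N -> y i = z i) -> h_mx y n N = h_mx z n N.
Proof. by move=> yz; apply/matrixP => i k; rewrite !mxE; apply: eq_geos. Qed.

Definition nat_ext (T : nmodType) n (f : 'I_n -> T) (i : nat) : T :=
  oapp f 0 (insub i).

Lemma nat_extE (T : nmodType) n (f : 'I_n -> T) (i : 'I_n) : nat_ext f i = f i.
Proof. by rewrite /nat_ext valK. Qed.

(* By Cauchy-Binet, the sum of [s_mu(x) s_mu(u)] over partitions [mu] with at
   most [n] parts, all at most [N - n]. *)
Definition schur_kernel n N : {mpoly int[n + n]} :=
  \det (h_mx (nat_ext (fun i : 'I_n => 'X_(lshift n i))) n N *m
       (h_mx (nat_ext (fun i : 'I_n => 'X_(rshift n i))) n N)^T).

(** Evaluation is a ring morphism, so it commutes with [geos] and with determinants. *)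
Lemma eval_schur_kernel n N (x u : 'I_n -> ratfun n) :
  eval_xu x u (schur_kernel n N) =
  \det (h_mx (nat_ext x) n N *m (h_mx (nat_ext u) n N)^T).
Proof.
pose h k := match split k with inl i => x i | inr j => u j end.
pose phi : {rmorphism {mpoly int[n + n]} -> ratfun n} := mmap (fun z : int => z%:~R) h.
rewrite -[LHS]/(phi (schur_kernel n N)) -det_map_mx map_mxM -map_trmx !map_h_mx.
have phiX k : phi 'X_k = h k.
  exact: (etrans (mmapX h (intr : {rmorphism int -> ratfun n}) U_(k)%MM) (mmap1U h k)).
have -> : h_mx (phi \o nat_ext (fun i : 'I_n => 'X_(lshift n i))) n N = h_mx (nat_ext x) n N.
  apply: h_mx_eq => i il; rewrite -[i]/(val (Ordinal il)) /comp !nat_extE phiX /h.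
  by rewrite (unsplitK (inl _)).
have -> : h_mx (phi \o nat_ext (fun i : 'I_n => 'X_(rshift n i))) n N = h_mx (nat_ext u) n N.
  apply: h_mx_eq => i il; rewrite -[i]/(val (Ordinal il)) /comp !nat_extE phiX /h.
  by rewrite (unsplitK (inr _)).
by [].
Qed.

(** * Distinctness of the indeterminates and the final identity *)

Lemma xvar_inj n : injective (@xvar n).
Proof.
move=> i j /eqP; rewrite tofrac_eq => /eqP /(congr1 (fun p => p@_U_(lshift n i))).
rewrite !mcoeffXU eqxx; case: eqP => // /lshift_inj //.
Qed.

Lemma tvar_inj n : injective (@tvar n).
Proof.
move=> i j /eqP; rewrite tofrac_eq => /eqP /(congr1 (fun p => p@_U_(rshift n i))).
rewrite !mcoeffXU eqxx; case: eqP => // /rshift_inj //.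
Qed.

(** Makes the denominators x_i / t_j - 1 nonzero. *)
Lemma xvar_neq_tvar n (i j : 'I_n) : xvar i != tvar j.
Proof.
rewrite tofrac_eq; apply/eqP => /(congr1 (fun p => p@_U_(lshift n i))).
by rewrite !mcoeffXU eqxx eq_rlshift.
Qed.

Lemma tvar_neq0 n (j : 'I_n) : tvar j != 0.
Proof.
rewrite tofrac_eq0; apply/eqP => /(congr1 (fun p => p@_U_(rshift n j))).
by rewrite mcoeffXU mcoeff0 eqxx.
Qed.

(** The x_i and 1 / t_j are algebraically independent, so the first identity determines [P]; putting
    [0] for 1 / t_j in [P] is the evaluation at infinity. *)
Theorem corollary3p28 (m n l : nat) (hl : (1 <= l)%N) (hln : (l <= n)%N) :
  let x := @xvar n in
  let t := @tvar n in
  exists P : {mpoly int[n + n]},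
    eval_xu x (fun j => (t j)^-1) P =
      (\prod_(i < n) \prod_(j < n | (i < j)%N)
         ((x i - x j) * ((t i)^-1 - (t j)^-1))^-1) *
      \det (\matrix_(i < n, j < n)
         (((x i * (t j)^-1) ^+ (m + n) - 1) / (x i * (t j)^-1 - 1)))
    /\
    \sum_(la : l.-tuple 'I_m.+1 | is_part (map_tuple val la))
      (\prod_(i < l) t (widen_ord hln i) ^+ (m - tnth la i)) *
      refined_g (map_tuple val la) x
        (fun r : 'I_l.-1 => t (widen_ord (leq_trans (leq_pred l) hln) r))
    = (\prod_(i < l) t (widen_ord hln i) ^+ m) *
      eval_xu x (fun j => if (j < l)%N then (t j)^-1 else 0) P.
Proof.
move=> x t; exists (schur_kernel n (m + n)); rewrite !eval_schur_kernel; split.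
  set ti := fun j => (t j)^-1.
  have := det_h_mx_vandermonde (nat_ext x) (nat_ext ti) n (m + n).
  (* The Vandermonde factors come as [y j - y i]; the two sign changes cancel. *)
  have -> : \det (pow_mx (nat_ext x) n n) * \det (pow_mx (nat_ext ti) n n) =
      \prod_(i < n) \prod_(j < n | (i < j)%N) ((x i - x j) * ((t i)^-1 - (t j)^-1)).
    rewrite !det_pow_mx -big_split; apply: eq_bigr => i _.
    rewrite -big_split; apply: eq_bigr => j _; rewrite !nat_extE /ti /=; ring.
  have -> : \matrix_(i < n, j < n) \sum_(k < m + n) (nat_ext x i * nat_ext ti j) ^+ k =
      \matrix_(i < n, j < n)
         (((x i * (t j)^-1) ^+ (m + n) - 1) / (x i * (t j)^-1 - 1)).
    apply/matrixP => i j; rewrite !mxE !nat_extE /ti subrX1 [RHS]mulrC mulKf //.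
    rewrite subr_eq0; apply/eqP => /(congr1 (fun z => z * t j)).
    rewrite mulfVK ?tvar_neq0 // mul1r => /eqP; exact/negP/xvar_neq_tvar.
  move=> <-; rewrite (eq_bigr (fun i : 'I_n => (\prod_(j < n | (i < j)%N)
      ((x i - x j) * ((t i)^-1 - (t j)^-1)))^-1)); last by move=> i _; rewrite prodfV.
  rewrite prodfV mulKf //; apply/prodf_neq0 => i _; apply/prodf_neq0 => j ij.
  have ij' : i != j by rewrite neq_ltn ij.
  rewrite mulf_neq0 // subr_eq0 ?(inj_eq (@xvar_inj n)) //.
  by rewrite (inj_eq (@invr_inj _)) (inj_eq (@tvar_inj n)).
pose xs := nat_ext x; pose ts := nat_ext t.
pose us := nat_ext (fun j : 'I_n => if (j < l)%N then (t j)^-1 else 0).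
have tsE (i : 'I_l) : ts i = t (widen_ord hln i).
  exact: (nat_extE t (widen_ord hln i)).
have usE i : (i < l)%N -> us i = (ts i)^-1.
  move=> il; have iN := leq_trans il hln.
  by rewrite /us /ts -[i]/(val (Ordinal iN)) !nat_extE /= il.
have us0 i : (l <= i)%N -> us i = 0.
  by move=> li; rewrite /us /nat_ext; case: insubP => //= j _ ->; rewrite ltnNge li.
pose g := geos xs n (delta (ratfun n) l).
have g0 e : (e < l)%N -> g e = 0 by apply: geos_lt.
(* Both sides equal this determinant: the left by [jacobi_trudi] and [rectangular_sum], the right by
   [det_h_mx_stable] and [det_h_mx_inv]. *)
transitivity (\det (\matrix_(i < l, j < l) geos ts l g (m + (l - i) + j))).
  rewrite -rectangular_sum //.
  rewrite (reindex (fun nu : {ffun 'I_l -> 'I_m.+1} => [tuple nu i | i < l])) /=; last first.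
    exists (fun la : l.-tuple 'I_m.+1 => [ffun i => tnth la i]) => [nu|la] _.
      by apply/ffunP => i; rewrite ffunE tnth_mktuple.
    by apply: eq_from_tnth => i; rewrite tnth_mktuple ffunE.
  have nuE (nu : {ffun 'I_l -> 'I_m.+1}) : [ffun i => tnth [tuple nu i | i < l] i] = nu.
    by apply/ffunP => i; rewrite ffunE tnth_mktuple.
  apply: eq_big => [nu|nu]; rewrite is_part_decr nuE // => nud; congr (_ * _).
    by apply: eq_bigr => i _; rewrite tnth_mktuple tsE.
  rewrite (@refined_g_fill_sum _ _ _ _ _ _ _ xs ts) ?nuE //.
  - by rewrite jacobi_trudi.
  - by move=> i; apply: nat_extE.
  - by move=> i; exact: (nat_extE t (widen_ord _ i)).
rewrite -(@det_h_mx_inv _ ts us) //.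
- congr (_ * _); first by apply: eq_bigr => i _; rewrite tsE.
  by rewrite -det_h_mx_stable.
- by move=> q ql; rewrite usE // mulfV // (tsE (Ordinal ql)) tvar_neq0.
move=> i j /andP[ij jl]; rewrite (tsE (Ordinal jl)) (tsE (Ordinal (ltn_trans ij jl))).
by rewrite (inj_eq (@tvar_inj n)) -val_eqE /= neq_ltn ij.
Qed.
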